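(* Fix a game with $m$ optimizer actions and $n$ learner actions, and a learner payoff $u_L:[m]\times[n]\to[-1,1]$ satisfying the standing assumptions. There exist infinitely many Pareto-optimal asymptotic menus.
   Context: The optimizer has action set $[m]$ and the learner has action set $[n]$. $\Delta_k$ is the simplex over $[k]$; $\Delta_{mn}$ is the set of probability distributions over $[m]\times[n]$. $x\otimes y$ is the product distribution. Payoffs $u_L,u_O:[m]\times[n]\to[-1,1]$ are extended (multi)linearly to $\Delta_m\times\Delta_n$ and to $\Delta_{mn}$. $\mathrm{BR}_L(x)=\arg\max_{j\in[n]}u_L(x,j)$. Standing assumptions on $u_L$: (1) there is a unique pair $(i^*,j^* )\in[m]\times[n]$ maximizing $u_L$; (2) the learner has no weakly dominated action, i.e. every $j\in[n]$ for which some $x\in\Delta_m$ has $j\in\mathrm{BR}_L(x)$ also admits some $x'\in\Delta_m$ with $\mathrm{BR}_L(x')=\{j\}$. Asymptotic menus. A learning algorithm $\mathcal{A}=\{A^T\}_{T\in\mathbb{N}}$ consists, for each horizon $T$, of functions $A^T_t:\Delta_m^{t-1}\to\Delta_n$; against $(x_1,\dots,x_T)\in\Delta_m^T$ the learner plays $y_t=A^T_t(x_1,\dots,x_{t-1})$. $\mathcal{M}(A^T)$ is the convex hull of all points $\frac1T\sum_{t=1}^T x_t\otimes y_t$ over all optimizer sequences. If $\mathcal{M}(A^1),\mathcal{M}(A^2),\dots$ converges in the Hausdorff metric, the (closed) limit is the asymptotic menu of $\mathcal{A}$. A subset of $\Delta_{mn}$ is an asymptotic menu if it arises this way from some learning algorithm.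 Pareto-optimality. For an asymptotic menu $\mathcal{M}$ and optimizer payoff $u_O$, $V_L(\mathcal{M},u_O)=\max\{u_L(\varphi)\mid\varphi\in\arg\max_{\varphi\in\mathcal{M}}u_O(\varphi)\}$. An asymptotic menu $\mathcal{M}'$ Pareto-dominates $\mathcal{M}$ if $V_L(\mathcal{M}',u_O)\ge V_L(\mathcal{M},u_O)$ for all $u_O:[m]\times[n]\to[-1,1]$, with strict inequality for at least one $u_O$. An asymptotic menu is Pareto-optimal if no asymptotic menu Pareto-dominates it.
   Formalization: The formal theorem assumes m ≥ 2 and n ≥ 2; if m = 1 or n = 1, the standing assumptions can hold but there is exactly one Pareto-optimal asymptotic menu, so the claim as stated fails there. *)

(* Defs.v *)
From HB Require Import structures.
From mathcomp Require Import all_boot all_order all_algebra.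
From mathcomp Require Import all_classical all_reals all_analysis.

Set Implicit Arguments.
Unset Strict Implicit.
Unset Printing Implicit Defensive.

Import Order.TTheory GRing.Theory Num.Theory.
Import numFieldTopology.Exports numFieldNormedType.Exports.

Local Open Scope classical_set_scope.
Local Open Scope ring_scope.

Definition simplex (R : realType) (k : nat) : set 'rV[R]_k :=
  [set x | (forall i, 0 <= x 0 i) /\ \sum_i x 0 i = 1].

(* Distributions over [m] x [n], as matrices. *)
Definition joint_simplex (R : realType) (m n : nat) : set 'M[R]_(m, n) :=
  [set phi | (forall i j, 0 <= phi i j) /\ \sum_i \sum_j phi i j = 1].

Definition tensor (R : realType) (m n : nat)
  (x : 'rV[R]_m) (y : 'rV[R]_n) : 'M[R]_(m, n) := \matrix_(i, j) (x 0 i * y 0 j).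

Definition bounded_payoff (R : realType) (m n : nat) (u : 'I_m -> 'I_n -> R) :=
  forall i j, -1 <= u i j <= 1.

Definition payoff (R : realType) (m n : nat) (u : 'I_m -> 'I_n -> R)
  (phi : 'M[R]_(m, n)) : R := \sum_i \sum_j phi i j * u i j.

Definition payoff_against (R : realType) (m n : nat) (u : 'I_m -> 'I_n -> R)
  (x : 'rV[R]_m) (j : 'I_n) : R := \sum_i x 0 i * u i j.

Definition best_responses (R : realType) (m n : nat) (u : 'I_m -> 'I_n -> R)
  (x : 'rV[R]_m) : set 'I_n :=
  [set j | forall k, payoff_against u x k <= payoff_against u x j].

Definition unique_max_profile (R : realType) (m n : nat)
  (u : 'I_m -> 'I_n -> R) : Prop :=
  exists! p : 'I_m * 'I_n, forall q : 'I_m * 'I_n, u q.1 q.2 <= u p.1 p.2.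

Definition no_weakly_dominated_action (R : realType) (m n : nat)
  (u : 'I_m -> 'I_n -> R) : Prop :=
  forall j : 'I_n,
    (exists2 x, simplex x & best_responses u x j) ->
    exists2 x', simplex x' & best_responses u x' = [set j].

(* [act A T h] is the learner's mixed action at horizon [T] after the optimizer
   has played the history [h]; the round is [(size h).+1], so only histories
   of mixed actions with [size h < T] matter. *)
Record learning_algorithm (R : realType) (m n : nat) := LearningAlgorithm {
  act : nat -> seq 'rV[R]_m -> 'rV[R]_n ;
  act_simplex : forall (T : nat) (h : seq 'rV[R]_m), (size h < T)%N ->
    (forall x, x \in h -> simplex x) -> simplex (act T h) }.

Definition average_play (R : realType) (m n : nat)
  (A : learning_algorithm R m n) (T : nat) (x : T.-tuple 'rV[R]_m) :
  'M[R]_(m, n) :=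
  T%:R^-1 *: \sum_(t < T) tensor (tnth x t) (act A T (take t x)).

Definition convex_hull (R : realType) (m n : nat) (S : set 'M[R]_(m, n)) :
  set 'M[R]_(m, n) :=
  smallest (@convex_set R 'M[R]_(m, n)) S.

Definition horizon_menu (R : realType) (m n : nat)
  (A : learning_algorithm R m n) (T : nat) : set 'M[R]_(m, n) :=
  convex_hull [set average_play A x |
    x in [set x : T.-tuple 'rV[R]_m | forall t, simplex (tnth x t)]].

(* The Hausdorff distance for the entrywise sup metric; it is [+oo] between
   sets that lie in no common thickening, e.g. if exactly one is empty. *)
Definition hausdorff_dist (R : realType) (m n : nat)
  (X Y : set 'M[R]_(m, n)) : \bar R :=
  ereal_inf [set e%:E | e in [set e : R | [/\ 0 < e,
    (forall x, X x -> exists2 y, Y y & ball x e y) &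
    (forall y, Y y -> exists2 x, X x & ball y e x)]]].

Definition asymptotic_menu (R : realType) (m n : nat)
  (M : set 'M[R]_(m, n)) : Prop :=
  [/\ M `<=` @joint_simplex R m n, closed M &
      exists A : learning_algorithm R m n,
        hausdorff_dist (horizon_menu A T) M @[T --> \oo] --> 0%E].

Definition payoff_maximizers (R : realType) (m n : nat)
  (u : 'I_m -> 'I_n -> R) (M : set 'M[R]_(m, n)) : set 'M[R]_(m, n) :=
  [set phi | M phi /\ forall psi, M psi -> payoff u psi <= payoff u phi].

(* On an asymptotic menu, which is nonempty and compact, this supremum is
   attained, i.e. it is a maximum. *)
Definition learner_value (R : realType) (m n : nat)
  (uL : 'I_m -> 'I_n -> R) (M : set 'M[R]_(m, n)) (uO : 'I_m -> 'I_n -> R) : R :=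
  sup [set payoff uL phi | phi in payoff_maximizers uO M].

Definition pareto_dominates (R : realType) (m n : nat)
  (uL : 'I_m -> 'I_n -> R) (M' M : set 'M[R]_(m, n)) : Prop :=
  (forall uO : 'I_m -> 'I_n -> R, bounded_payoff uO ->
     learner_value uL M uO <= learner_value uL M' uO) /\
  (exists2 uO : 'I_m -> 'I_n -> R, bounded_payoff uO &
     learner_value uL M uO < learner_value uL M' uO).

Definition pareto_optimal (R : realType) (m n : nat)
  (uL : 'I_m -> 'I_n -> R) (M : set 'M[R]_(m, n)) : Prop :=
  asymptotic_menu M /\
  forall M', asymptotic_menu M' -> ~ pareto_dominates uL M' M.

(* Main.v *)
(* Let E be the pure profile at which u_L is maximal, with actions is_ and js.  The
   learner who plays js until the optimizer departs from is_, and then a fixed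
   mixed action y forever, has the menu conv ({E} u {x (x) y : x}).  It is
   inclusion-minimal among the menus containing E: a menu inside it must contain
   a response to every x, and x (x) y is the only one available unless x is pure
   is_.  A menu that Pareto-dominates a menu M containing E must itself contain E,
   and cannot have a point outside M: comparing the support functions of both
   menus in the directions u + l u_L with l >= 0, where u separates that point
   from M, gives a payoff at which the learner is strictly worse off.  So the
   menus of these trigger strategies are Pareto-optimal, and distinct y give
   distinct menus. *)
Require Import Defs.
From mathcomp Require Import all_boot all_order all_algebra.
From mathcomp Require Import all_classical all_reals all_analysis.
From mathcomp Require Import ring lra.

Set Implicit Arguments.
Unset Strict Implicit.
Unset Printing Implicit Defensive.

Import Order.TTheory GRing.Theory Num.Theory.
Import numFieldTopology.Exports numFieldNormedType.Exports.

Local Open Scope classical_set_scope.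
Local Open Scope ring_scope.

(** * Closed sets and entrywise balls *)

Lemma closed_approx (R : realType) (T : pseudoMetricType R) (M : set T) (p : T) :
  closed M -> (forall e, 0 < e -> exists2 q, M q & ball p e q) -> M p.
Proof.
move=> cM H; apply: cM => B /nbhs_ballP[e e0 eB].
by have [q Mq pq] := H e e0; exists q; split=> //; apply: eB.
Qed.

Lemma mx_ballP (R : realType) (m n : nat) (e : R) (p q : 'M[R]_(m, n)) :
  0 < e -> ball p e q <-> forall i j, `|p i j - q i j| < e.
Proof.
move=> e0; split; first by move=> -[_ pq] i j; have := pq i j; rewrite -ball_normE.
by move=> pq; split=> // i j; rewrite -ball_normE; apply: pq.
Qed.

(** * Payoffs and the joint simplex *)

Section Payoff.
Context {R : realType} {m n : nat}.
Implicit Types (u v : 'I_m -> 'I_n -> R) (p q : 'M[R]_(m, n)).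

Lemma payoffD u v (c : R) p :
  payoff (fun i j => u i j + c * v i j) p = payoff u p + c * payoff v p.
Proof.
rewrite /payoff mulr_sumr -big_split; apply: eq_bigr => i _ /=.
rewrite mulr_sumr -big_split; apply: eq_bigr => j _ /=; ring.
Qed.

Lemma payoffZ u (c : R) p : payoff (fun i j => c * u i j) p = c * payoff u p.
Proof.
rewrite /payoff mulr_sumr; apply: eq_bigr => i _ /=.
by rewrite mulr_sumr; apply: eq_bigr => j _ /=; ring.
Qed.

Lemma payoff_comb u (a b : R) p q :
  payoff u (a *: p + b *: q) = a * payoff u p + b * payoff u q.
Proof.
rewrite /payoff !mulr_sumr -big_split; apply: eq_bigr => i _ /=.
rewrite !mulr_sumr -big_split; apply: eq_bigr => j _ /=.
by rewrite !mxE; ring.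
Qed.

(** Makes every entry a payoff, so that linear constraints on entries become half-spaces
    [payoff u p <= c]. *)
Lemma payoff_delta (i : 'I_m) (j : 'I_n) p :
  payoff (fun k l => (delta_mx i j : 'M[R]_(m, n)) k l) p = p i j.
Proof.
rewrite /payoff (bigD1 i) //= (bigD1 j) //= !mxE !eqxx mulr1.
rewrite big1 ?addr0; last by move=> l lj; rewrite mxE (negPf lj) andbF mulr0.
rewrite big1 ?addr0 // => k ki; rewrite big1 // => l _.
by rewrite mxE (negPf ki) mulr0.
Qed.

Lemma payoff_tensor_pure u i j :
  payoff u (tensor (delta_mx 0 i) (delta_mx 0 j)) = u i j.
Proof.
rewrite /payoff (bigD1 i) //= (bigD1 j) //= !mxE !eqxx !mul1r.
rewrite big1 ?addr0; last by move=> l lj; rewrite !mxE (negPf lj) mulr0 mul0r.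
rewrite big1 ?addr0 // => k ki; rewrite big1 // => l _.
by rewrite !mxE (negPf ki) !mul0r.
Qed.

Lemma payoff_cst (c : R) p : joint_simplex p -> payoff (fun _ _ => c) p = c.
Proof.
move=> [_ p1]; rewrite /payoff -[RHS]mul1r -p1 mulr_suml.
by apply: eq_bigr => i _; rewrite mulr_suml.
Qed.

Lemma payoff_le u v p : joint_simplex p -> (forall i j, u i j <= v i j) ->
  payoff u p <= payoff v p.
Proof.
by move=> [p0 _] uv; apply: ler_sum => i _; apply: ler_sum => j _; apply: ler_wpM2l.
Qed.

Lemma payoff_continuous u : continuous (payoff u).
Proof.
have sum_continuous (I : finType) (f : I -> 'M[R]_(m, n) -> R) :
    (forall i, continuous (f i)) -> continuous (fun p => \sum_i f i p).
  move=> cf; rewrite (_ : (fun p => _) = \sum_i f i); last first.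
    by apply/funext => p; rewrite fct_sumE.
  apply: (big_ind (fun g : 'M[R]_(m, n) -> R => continuous g)) => //.
  - exact: cst_continuous.
  - by move=> f1 f2 c1 c2 p; apply: continuousD; [exact: c1|exact: c2].
apply: (@sum_continuous _ (fun i p => \sum_j p i j * u i j)) => i.
apply: (@sum_continuous _ (fun j p => p i j * u i j)) => j p.
apply: (@continuousM _ _ (fun q : 'M[R]_(m, n) => q i j) (cst (u i j))).
  exact: coord_continuous.
exact: cst_continuous.
Qed.

Lemma closed_payoff_le u (c : R) : closed [set p | payoff u p <= c].
Proof.
apply: (@closed_comp _ _ (payoff u) [set x | x <= c]); last exact: closed_le.
by move=> p _; exact: payoff_continuous.
Qed.

Lemma closed_joint_simplex : closed (@joint_simplex R m n).
Proof.
(* An intersection of closed half-spaces: one per nonnegative entry, and two opposite ones for the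
   total mass. *)
have -> : @joint_simplex R m n =
    \bigcap_(k in [set: 'I_m * 'I_n])
      [set p | payoff (fun i j => -1 * (delta_mx k.1 k.2 : 'M[R]_(m, n)) i j) p <= 0]
    `&` ([set p | payoff (fun _ _ => 1) p <= 1]
    `&` [set p | payoff (fun _ _ => -1) p <= -1]).
  apply/seteqP; split=> p /=.
    move=> jp; split; last by rewrite !payoff_cst.
    by move=> [i j] _ /=; rewrite payoffZ payoff_delta mulN1r oppr_le0; case: jp.
  move=> [p0 [p1 p2]]; split.
    by move=> i j; have /= := p0 (i, j) I; rewrite payoffZ payoff_delta mulN1r oppr_le0.
  have S : payoff (fun _ _ => 1) p = \sum_i \sum_j p i j.
    by apply: eq_bigr => i _; apply: eq_bigr => j _; rewrite mulr1.
  apply/eqP; rewrite -S eq_le p1 /=.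
  have := payoffZ (fun _ _ => 1) (-1) p; rewrite mulr1 => E.
  by move: p2; rewrite E mulN1r lerN2.
apply: closedI; last by apply: closedI; exact: closed_payoff_le.
by apply: closed_bigI => k _; exact: closed_payoff_le.
Qed.

Lemma joint_simplex_le1 p i j : joint_simplex p -> p i j <= 1.
Proof.
move=> [p0 p1]; rewrite -p1 (bigD1 i) //= (bigD1 j) //= -addrA lerDl addr_ge0 //.
  by apply: sumr_ge0.
by apply: sumr_ge0 => k _; apply: sumr_ge0.
Qed.

(** A closed subset of the image of the cube [[0, 1]^(m * n)] under the continuous map [vec_mx]. *)
Lemma compact_joint_simplex : compact (@joint_simplex R m n).
Proof.
have cK : compact [set v : 'rV[R]_(m * n) | forall i, `[0, 1]%classic (v ord0 i)].
  apply: (@rV_compact R _ (fun=> `[(0 : R), 1]%classic)).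
  by move=> _; exact: segment_compact.
have vc : continuous (@vec_mx R m n).
  move=> v A /nbhs_ballP[e /= e0 eA]; apply/nbhs_ballP; exists e => //= w [_ vw].
  by apply: eA; split=> // i j; rewrite !mxE; apply: vw.
have cI := continuous_compact (continuous_subspaceT vc) cK.
apply: (subclosed_compact closed_joint_simplex cI) => p jp.
exists (mxvec p); last exact: mxvecK.
move=> k; case/mxvec_indexP: k => i j; rewrite mxvecE /= in_itv /=.
by rewrite joint_simplex_le1 // andbT; case: jp.
Qed.

End Payoff.

(** * Learner values of two menus *)

Section LearnerValue.
Context {R : realType} {m n : nat}.
Variable uL : 'I_m -> 'I_n -> R.
Implicit Types (u : 'I_m -> 'I_n -> R) (M : set 'M[R]_(m, n)).

(** Two maximizations in a row: the maximizers of [u] form the part of [M] in a closed half-space,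
    hence a compact set, on which [uL] attains its maximum. *)
Lemma learner_value_attained u M : compact M -> M !=set0 ->
  exists2 phi, payoff_maximizers u M phi & payoff uL phi = learner_value uL M u.
Proof.
move=> cM M0.
have within v A : {within A, continuous (@payoff R m n v)}.
  exact/continuous_subspaceT/payoff_continuous.
have [p /set_mem Mp maxp] := compact_EVT_max M0 cM (@within u M).
have maxE : payoff_maximizers u M =
    M `&` [set q | payoff (fun i j => -1 * u i j) q <= - payoff u p].
  apply/seteqP; split=> q /=; rewrite payoffZ mulN1r lerN2.
    by move=> [Mq maxq]; split=> //; exact: maxq.
  move=> [Mq pq]; split=> // r Mr; apply: le_trans pq; apply: maxp; exact/mem_set.
have cmax : compact (payoff_maximizers u M).
  rewrite maxE; apply: compact_closedI => //; exact: closed_payoff_le.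
have nmax : payoff_maximizers u M !=set0.
  by exists p; split=> // q Mq; apply: maxp; exact/mem_set.
have [phi /set_mem Hphi best] := compact_EVT_max nmax cmax (@within uL _).
exists phi => //; apply/eqP; rewrite eq_le; apply/andP; split.
  apply: ub_le_sup; last by exists phi.
  by exists (payoff uL phi) => _ [q Hq <-]; apply: best; exact/mem_set.
apply: ge_sup; first by exists (payoff uL phi), phi.
by move=> _ [q Hq <-]; apply: best; exact/mem_set.
Qed.

Lemma learner_valueZ (c : R) u M : 0 < c ->
  learner_value uL M (fun i j => c * u i j) = learner_value uL M u.
Proof.
move=> c0; congr (sup (image _ _)); apply/seteqP.
by split=> p [Mp maxp]; split=> // q Mq; have := maxp q Mq;
  rewrite !payoffZ ler_pM2l.
Qed.

(** Together with [learner_valueZ], this extends a comparison of learner values from bounded payoffs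
    to all payoffs, in particular to [u + l uL] with [l] large. *)
Lemma bounded_payoff_scale u :
  exists2 c : R, 0 < c & bounded_payoff (fun i j => c * u i j).
Proof.
pose S := \sum_i \sum_j `|u i j|.
have uS i j : `|u i j| <= S.
  rewrite /S (bigD1 i) //= (bigD1 j) //= -addrA lerDl addr_ge0 //.
    by apply: sumr_ge0.
  by apply: sumr_ge0 => k _; apply: sumr_ge0.
have S0 : 0 <= S by apply: sumr_ge0 => i _; apply: sumr_ge0.
have S1 : 0 < 1 + S by rewrite ltr_pwDl.
exists (1 + S)^-1; first by rewrite invr_gt0.
move=> i j; rewrite -ler_norml normrM gtr0_norm ?invr_gt0 //.
by rewrite mulrC ler_pdivrMr // mul1r (le_trans (uS i j)) // lerDr.
Qed.

Hypothesis huL : bounded_payoff uL.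
Variables (is_ : 'I_m) (js : 'I_n).
Hypothesis hmax : forall i j, (i, j) != (is_, js) -> uL i j < uL is_ js.

Let E : 'M[R]_(m, n) := tensor (delta_mx 0 is_) (delta_mx 0 js).

(** The gap [v] to the maximum is nonnegative, and positive off [(is_, js)]. Its payoff at [phi] is
    at most 0, so [phi] has no mass off that profile. *)
Lemma payoff_max_unique phi : joint_simplex phi -> uL is_ js <= payoff uL phi ->
  phi = E.
Proof.
move=> jphi; have [p0 p1] := jphi; move=> le.
pose v i j := uL is_ js + -1 * uL i j.
have v0 i j : 0 <= phi i j * v i j.
  rewrite mulr_ge0 // /v mulN1r subr_ge0.
  by have [[-> ->]|/hmax/ltW] := eqVneq (i, j) (is_, js).
have V0 : payoff v phi <= 0.
  by rewrite /v (payoffD (fun _ _ => uL is_ js)) payoff_cst // mulN1r subr_le0.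
have z i j : (i, j) != (is_, js) -> phi i j = 0.
  move=> ne; have : phi i j * v i j <= 0.
    apply: le_trans V0; rewrite /payoff (bigD1 i) //= (bigD1 j) //= -addrA lerDl.
    rewrite addr_ge0 //; first by apply: sumr_ge0.
    by apply: sumr_ge0 => k _; apply: sumr_ge0.
  have vp : 0 < v i j by rewrite /v mulN1r subr_gt0 hmax.
  by rewrite pmulr_lle0 // => le0; apply/eqP; rewrite eq_le le0 p0.
have p11 : phi is_ js = 1.
  move: p1; rewrite (bigD1 is_) //= (bigD1 js) //= [X in _ + X]big1 ?addr0.
    rewrite big1 ?addr0 // => j jj; apply: z; apply: contra jj.
    by rewrite xpair_eqE => /andP[].
  move=> i ii; apply: big1 => j _; apply: z; apply: contra ii.
  by rewrite xpair_eqE => /andP[].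
apply/matrixP => i j; rewrite !mxE /=.
have [[-> ->]|ne] := eqVneq (i, j) (is_, js); first by rewrite !eqxx mulr1.
rewrite z //; move: ne; rewrite xpair_eqE.
by case: eqP; case: eqP; rewrite ?mulr0 ?mul0r.
Qed.

(* [h_k l], the maximum over [Mk] of the payoff [u + l uL], is convex in [l]
   with right derivative the learner's value.  If [M2] were never worse for the
   learner, [h_2 - h_1] would be nondecreasing; but it is positive at [0] by
   choice of [u] and nonpositive for large [l], when [E] maximizes
   [u + l uL]. *)
Lemma separated_value_lt M1 M2 u psi :
  compact M1 -> M1 `<=` @joint_simplex R m n -> M1 E ->
  compact M2 -> M2 `<=` @joint_simplex R m n -> M2 psi ->
  (forall phi, M1 phi -> payoff u phi < payoff u psi) ->
  exists2 uO, bounded_payoff uO & learner_value uL M2 uO < learner_value uL M1 uO.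
Proof.
move=> c1 j1 M1E c2 j2 M2psi sep; apply: contrapT => nex.
have dom v : learner_value uL M1 v <= learner_value uL M2 v.
  have [c c0 bc] := bounded_payoff_scale v.
  rewrite -(learner_valueZ v M1 c0) -(learner_valueZ v M2 c0) leNgt.
  by apply/negP => lt; apply: nex; exists (fun i j => c * v i j).
pose w (l : R) i j := u i j + l * uL i j.
have /choice[f1 f1P] : forall l, exists p, payoff_maximizers (w l) M1 p /\
    payoff uL p = learner_value uL M1 (w l).
  by move=> l; have [||p ? ?] := @learner_value_attained (w l) M1; [|exists E|exists p].
have /choice[f2 f2P] : forall l, exists p, payoff_maximizers (w l) M2 p /\
    payoff uL p = learner_value uL M2 (w l).
  by move=> l; have [||p ? ?] := @learner_value_attained (w l) M2; [|exists psi|exists p].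
pose V1 l := payoff uL (f1 l); pose V2 l := payoff uL (f2 l).
pose h1 l := payoff u (f1 l) + l * V1 l; pose h2 l := payoff u (f2 l) + l * V2 l.
have V12 l : V1 l <= V2 l.
  by rewrite /V1 /V2; case: (f1P l) => _ ->; case: (f2P l) => _ ->; apply: dom.
have V1B l : -1 <= V1 l <= 1.
  have [[M1f _] _] := f1P l; have jf := j1 _ M1f.
  apply/andP; split.
    rewrite -[leLHS](payoff_cst _ jf).
    by apply: payoff_le => // i j; have /andP[] := huL i j.
  rewrite -[leRHS](payoff_cst _ jf).
  by apply: payoff_le => // i j; have /andP[] := huL i j.
(* [V1 l] is a subgradient of [h1] at [l]: the maximizer [f1 l] stays available at parameter [k]. *)
have H1 l k : h1 l + (k - l) * V1 l <= h1 k.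
  have [[M1f _] _] := f1P l; have [[_ mx] _] := f1P k.
  by have := mx _ M1f; rewrite !payoffD -/(V1 l) -/(V1 k) /h1; lra.
have H2 l k : h2 l + (k - l) * V2 l <= h2 k.
  have [[M2f _] _] := f2P l; have [[_ mx] _] := f2P k.
  by have := mx _ M2f; rewrite !payoffD -/(V2 l) -/(V2 k) /h2; lra.
pose g l := h2 l - h1 l.
(* The subgradient of [h2] at [l] bounds its growth from below, that of [h1] at [l + d] bounds its
   growth from above, and [V12] replaces [V2 l] by [V1 l]. *)
have step l d : 0 <= d -> g l + d * (V1 l - V1 (l + d)) <= g (l + d).
  move=> d0; have := H1 (l + d) l; have := H2 l (l + d).
  have := ler_wpM2l d0 (V12 l).
  have -> : l - (l + d) = - d by ring.
  rewrite [l + d - l]addrC addKr mulNr mulrBr /g.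
  move: (d * V1 l) (d * V1 (l + d)) (d * V2 l) (h1 _) (h1 _) (h2 _) (h2 _).
  by move=> a b c p q r s; lra.
(* Over [k] steps the losses telescope to one difference of values of [V1] times [d], which is at
   most [2 * d] however many steps are made. *)
have steps d k : 0 <= d -> g 0 + d * (V1 0 - V1 (k%:R * d)) <= g (k%:R * d).
  move=> d0; elim: k => [|k IH]; first by rewrite mul0r subrr mulr0 addr0.
  have -> : k.+1%:R * d = k%:R * d + d by rewrite -natr1 mulrDl mul1r.
  have := step (k%:R * d) d d0; move: IH; rewrite !mulrBr.
  move: (d * V1 0) (d * V1 (k%:R * d)) (d * V1 (k%:R * d + d)).
  by move: (g 0) (g _) (g _) => p q r a b c; lra.
have g0 : 0 < g 0.
  rewrite /g /h1 /h2 !mul0r !addr0 subr_gt0.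
  have [[M1f _] _] := f1P 0; have [[_ mx] _] := f2P 0.
  apply: (lt_le_trans (sep _ M1f)).
  by have := mx _ M2psi; rewrite !payoffD !mul0r !addr0.
(* Each summand is a tilt at which [(is_, js)] is at least as good as [(i, j)] for [u + l uL]; the
   sum dominates them all. The summand at [(is_, js)] is 0. *)
pose L := \sum_i \sum_j `|u i j - u is_ js| / (uL is_ js - uL i j).
have gap0 i j : 0 <= uL is_ js - uL i j.
  by rewrite subr_ge0; have [[-> ->]|/hmax/ltW] := eqVneq (i, j) (is_, js).
have Lt0 i j : 0 <= `|u i j - u is_ js| / (uL is_ js - uL i j).
  by rewrite divr_ge0.
have L0 : 0 <= L by apply: sumr_ge0 => i _; apply: sumr_ge0.
have wL i j : w L i j <= w L is_ js.
  have [[-> ->]//|ne] := eqVneq (i, j) (is_, js).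
  have gap : 0 < uL is_ js - uL i j by rewrite subr_gt0 hmax.
  have : `|u i j - u is_ js| <= L * (uL is_ js - uL i j).
    rewrite -ler_pdivrMr // /L (bigD1 i) //= (bigD1 j) //= -addrA lerDl.
    rewrite addr_ge0 //; first by apply: sumr_ge0.
    by apply: sumr_ge0 => k _; apply: sumr_ge0.
  by move=> /(le_trans (ler_norm _)); rewrite /w; lra.
have gL : g L <= 0.
  rewrite /g subr_le0; apply: (@le_trans _ _ (w L is_ js)).
    have [[M2f _] _] := f2P L; rewrite /h2 /V2 -payoffD.
    by rewrite -(payoff_cst (w L is_ js) (j2 _ M2f)); apply: payoff_le => //; apply: j2.
  have [[_ mx] _] := f1P L; have := mx _ M1E.
  by rewrite payoff_tensor_pure payoffD.
(* With [N] steps of size [L / N], the total loss [2 * L / N] is below [g 0], so [g L] would be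
   positive, against [gL]. *)
have [N LN] : exists N : nat, 2 * L / g 0 < N%:R.
  exists (Num.bound (2 * L / g 0)); apply: archi_boundP.
  by rewrite divr_ge0 ?mulr_ge0 // ltW.
have N0 : 0 < N%:R :> R by apply: le_lt_trans LN; rewrite divr_ge0 ?mulr_ge0 // ltW.
have d0 : 0 <= L / N%:R by rewrite divr_ge0 // ltW.
have := steps (L / N%:R) N d0.
rewrite [N%:R * _]mulrC divfK ?gt_eqF // => st.
have dlt : 2 * (L / N%:R) < g 0.
  by rewrite mulrA ltr_pdivrMr // [g 0 * _]mulrC -ltr_pdivrMr.
have /andP[a1 a2] := V1B 0; have /andP[b1 b2] := V1B L.
have : (L / N%:R) * (-2) <= (L / N%:R) * (V1 0 - V1 L).
  by apply: ler_wpM2l => //; lra.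
move: st gL g0 dlt; rewrite mulrN (mulrC 2).
by move: (g L) (g 0) (_ * 2) (_ * (V1 0 - _)) => p q r s; lra.
Qed.

End LearnerValue.

(** * Asymptotic menus *)

Section AsymptoticMenu.
Context {R : realType} {m n : nat}.
Implicit Types (M : set 'M[R]_(m, n)) (x : 'rV[R]_m) (y : 'rV[R]_n).

Lemma convex_setP (S : set 'M[R]_(m, n)) :
  @convex_set R 'M[R]_(m, n) S <->
  forall p q (t : R), 0 <= t <= 1 -> S p -> S q -> S (t *: p + (1 - t) *: q).
Proof.
split=> cS p q t.
  move=> /andP[t0 t1] Sp Sq.
  by have /set_mem := cS p q (Itv01 t0 t1) (mem_set Sp) (mem_set Sq).
move=> /set_mem Sp /set_mem Sq; apply/mem_set/cS => //.
by rewrite ge0 le1.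
Qed.

Lemma simplexE k : @simplex R k = @joint_simplex R 1 k.
Proof.
apply/seteqP; split=> x [x0 x1]; split.
- by move=> i j; rewrite ord1.
- by rewrite big_ord1.
- by move=> i; apply: x0.
- by rewrite -x1 big_ord1.
Qed.

Lemma simplex_le1 k (x : 'rV[R]_k) i : simplex x -> x 0 i <= 1.
Proof. by rewrite simplexE; exact: joint_simplex_le1. Qed.

Lemma simplex_pure k (i : 'I_k) : simplex (delta_mx 0 i : 'rV[R]_k).
Proof.
split=> [j|]; first by rewrite mxE ler0n.
rewrite (bigD1 i) //= mxE !eqxx big1 ?addr0 // => j ji.
by rewrite mxE (negPf ji) andbF.
Qed.

Lemma simplex_comb k (x y : 'rV[R]_k) (t : R) : 0 <= t <= 1 ->
  simplex x -> simplex y -> simplex (t *: x + (1 - t) *: y).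
Proof.
move=> /andP[t0 t1] [x0 x1] [y0 y1]; split.
  by move=> i; rewrite !mxE addr_ge0 // mulr_ge0 // subr_ge0.
under eq_bigr do rewrite !mxE.
by rewrite big_split /= -!mulr_sumr x1 y1; ring.
Qed.

Lemma simplex_average k T (f : 'I_T.+1 -> 'rV[R]_k) :
  (forall t, simplex (f t)) -> simplex (T.+1%:R^-1 *: \sum_t f t).
Proof.
move=> fS; split.
  move=> i; rewrite mxE summxE mulr_ge0 ?invr_ge0 ?ler0n //.
  by apply: sumr_ge0 => t _; case: (fS t).
under eq_bigr do rewrite mxE summxE.
rewrite -mulr_sumr exchange_big /= (eq_bigr (fun=> 1)); last by move=> t _; case: (fS t).
by rewrite sumr_const card_ord mulVf // pnatr_eq0.
Qed.

Lemma tensorZl a x y : tensor (a *: x) y = a *: tensor x y.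
Proof. by apply/matrixP => i j; rewrite !mxE mulrA. Qed.

Lemma tensor_suml (I : finType) (P : pred I) (f : I -> 'rV[R]_m) y :
  tensor (\sum_(t | P t) f t) y = \sum_(t | P t) tensor (f t) y.
Proof.
apply/matrixP => i j; rewrite !mxE !summxE mulr_suml.
by apply: eq_bigr => t _; rewrite mxE.
Qed.

Lemma tensor_sumr (I : finType) (f : I -> 'rV[R]_n) x :
  tensor x (\sum_t f t) = \sum_t tensor x (f t).
Proof.
apply/matrixP => i j; rewrite !mxE !summxE mulr_sumr.
by apply: eq_bigr => t _; rewrite mxE.
Qed.

Lemma tensorZr a x y : tensor x (a *: y) = a *: tensor x y.
Proof. by apply/matrixP => i j; rewrite !mxE; ring. Qed.

(** Extracts from the Hausdorff limit one positive horizon at each precision; horizon 0, where the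
    average has no meaning, is avoided. *)
Lemma menu_horizon_approx M : asymptotic_menu M ->
  exists A : learning_algorithm R m n, forall e : R, 0 < e -> exists T,
    (forall p, horizon_menu A T.+1 p -> exists2 q, M q & ball p e q) /\
    (forall q, M q -> exists2 p, horizon_menu A T.+1 p & ball q e p).
Proof.
move=> [_ _ [A cvgA]]; exists A => e e0.
have /cvgA : nbhs 0%E [set r : \bar R | (r < e%:E)%E].
  by exists e => //= r; rewrite /= sub0r normrN lte_fin; apply: le_lt_trans (ler_norm _).
move=> [N _ NT]; exists N.
have /NT /= : (N <= N.+1)%N by [].
move=> /ereal_inf_lt[_ [d [d0 d1 d2] <-]]; rewrite lte_fin => de.
split=> p.
  by move=> /d1[q Mq pq]; exists q => //; apply: le_ball pq; exact: ltW.
by move=> /d2[q Mq pq]; exists q => //; apply: le_ball pq; exact: ltW.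
Qed.

Lemma horizon_menu_average (A : learning_algorithm R m n) T (x : T.-tuple 'rV[R]_m) :
  (forall t, simplex (tnth x t)) -> horizon_menu A T (average_play A x).
Proof. by move=> xS; apply: sub_gen_smallest; exists x. Qed.

Lemma horizon_menu_convex (A : learning_algorithm R m n) T :
  @convex_set R 'M[R]_(m, n) (horizon_menu A T).
Proof.
apply/convex_setP => p q t t01 Hp Hq S [cS genS].
by have /convex_setP := cS; apply => //; [exact: Hp|exact: Hq].
Qed.

Lemma menu_compact M : asymptotic_menu M -> compact M.
Proof. by move=> [jM cM _]; exact: subclosed_compact cM compact_joint_simplex jM. Qed.

(** Convexity passes to the limit: approximate both points in a common horizon menu, mix them there,
    and return to [M], with error [e / 2] each way. *)
Lemma menu_convex M : asymptotic_menu M -> @convex_set R 'M[R]_(m, n) M.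
Proof.
move=> aM; apply/convex_setP => p q t t01 Mp Mq; have [_ cM _] := aM.
have [A HA] := menu_horizon_approx aM.
apply: (closed_approx cM) => e e0; have e2 : 0 < e / 2 by rewrite divr_gt0.
have [T [near1 near2]] := HA _ e2.
have [p' Hp' pp'] := near2 _ Mp; have [q' Hq' qq'] := near2 _ Mq.
have /convex_setP/(_ p' q' t t01 Hp' Hq') := @horizon_menu_convex A T.+1.
move=> /near1[r Mr rr]; exists r => //.
rewrite [e](splitr e); apply: ball_triangle rr.
apply/mx_ballP => // i j; rewrite !mxE.
have pp := (mx_ballP p p' e2).1 pp' i j; have qq := (mx_ballP q q' e2).1 qq' i j.
have /andP[t0 t1] := t01.
have -> : t * p i j + (1 - t) * q i j - (t * p' i j + (1 - t) * q' i j) =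
  t * (p i j - p' i j) + (1 - t) * (q i j - q' i j) by ring.
apply: le_lt_trans (ler_normD _ _) _.
rewrite !normrM (ger0_norm t0) (@ger0_norm _ (1 - t)) ?subr_ge0 //.
apply: (@le_lt_trans _ _ (Num.max `|p i j - p' i j| `|q i j - q' i j|)).
  set a := `|_|; set b := `|_|; set c := Num.max a b.
  have -> : c = t * c + (1 - t) * c by ring.
  by apply: lerD; apply: ler_wpM2l; rewrite ?subr_ge0 // le_max lexx ?orbT.
by rewrite gt_max pp qq.
Qed.

(** If the optimizer plays [x] in every round, the average play is [tensor x y] with [y] the mean
    reply. Compactness of the simplex gives a limit of these [y] as the precision improves. *)
Lemma menu_response M x : asymptotic_menu M -> simplex x ->
  exists2 y, simplex y & M (tensor x y).
Proof.
move=> aM xS; have [_ cM _] := aM.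
have [A HA] := menu_horizon_approx aM.
have near e : 0 < e -> exists2 y, simplex y & exists2 q, M q & ball (tensor x y) e q.
  move=> e0; have [T [near1 _]] := HA _ e0.
  exists (T.+1%:R^-1 *: \sum_(t < T.+1) act A T.+1 (take t (nseq_tuple T.+1 x))).
    apply: simplex_average => t; apply: act_simplex.
      by rewrite size_take size_nseq ltn_ord.
    by move=> z /mem_take; rewrite mem_nseq => /andP[_ /eqP->].
  apply: near1; rewrite tensorZr tensor_sumr.
  have -> : \sum_(t < T.+1) tensor x (act A T.+1 (take t (nseq_tuple T.+1 x))) =
      \sum_(t < T.+1) tensor (tnth (nseq_tuple T.+1 x) t)
        (act A T.+1 (take t (nseq_tuple T.+1 x))).
    by apply: eq_bigr => t _; rewrite tnth_nseq.
  by apply: horizon_menu_average => t; rewrite tnth_nseq.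
have /choice[ys ysP] : forall k, exists y, simplex y /\
    exists2 q, M q & ball (tensor x y) (k.+1%:R^-1) q.
  by move=> k; have [|y ? ?] := near (k.+1%:R^-1); [rewrite invr_gt0|exists y].
have cS : compact (@simplex R n) by rewrite simplexE; exact: compact_joint_simplex.
(* A cluster point [y] suffices: below, some [ys k] close to [y] is found with [k] so large that its
   own error is under [e / 2]. *)
have [] := cS (ys @ \oo) _.
  by exists 0%N => // k _; case: (ysP k).
move=> y [yS cy]; exists y => //; apply: (closed_approx cM) => e e0.
have e2 : 0 < e / 2 by rewrite divr_gt0.
have [N LN] : exists N : nat, (e / 2)^-1 < N%:R.
  by exists (Num.bound (e / 2)^-1); apply: archi_boundP; rewrite invr_ge0 ltW.
have tail : (ys @ \oo) [set ys k | k in [set k | (N <= k)%N]].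
  by exists N => // k Nk; exists k.
have [z [[k /= Nk <-] yz]] := cy _ _ tail (nbhsx_ballx y _ e2).
have [_ [q Mq zq]] := ysP k; exists q => //.
rewrite [e](splitr e); apply: (@ball_triangle _ _ (tensor x (ys k))).
  move/(mx_ballP _ _ e2) : yz => yz; apply/mx_ballP => // i j; rewrite !mxE.
  rewrite -mulrBr normrM; apply: le_lt_trans (yz 0 j).
  by rewrite ler_piMl // ger0_norm ?simplex_le1 //; case: xS.
apply: le_ball zq; rewrite -[leRHS]invrK lef_pV2 ?posrE ?invr_gt0 //.
by rewrite (le_trans (ltW LN)) // ler_nat ltnW.
Qed.

End AsymptoticMenu.

(** * The menu of a trigger strategy *)

Section TriggerMenu.
Context {R : realType} {m n : nat}.
Variables (is_ : 'I_m) (js : 'I_n) (y : 'rV[R]_n).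

Let ei : 'rV[R]_m := delta_mx 0 is_.
Let ej : 'rV[R]_n := delta_mx 0 js.

(* The convex hull of [ei (x) ej] and of all [x (x) y] with [x] in the simplex,
   where [w] stands for [(1 - a) x]. *)
Definition trigger_menu : set 'M[R]_(m, n) :=
  [set phi | exists a (w : 'rV[R]_m), [/\ 0 <= a, forall i, 0 <= w 0 i,
    a + \sum_i w 0 i = 1 & phi = a *: tensor ei ej + tensor w y]].

Lemma trigger_menuP phi : trigger_menu phi <->
  exists a x, [/\ 0 <= a <= 1, simplex x &
    phi = a *: tensor ei ej + (1 - a) *: tensor x y].
Proof.
split=> [[a [w [a0 w0 aw ->]]]|[a [x [/andP[a0 a1] [x0 x1] ->]]]].
  have s0 : 0 <= \sum_i w 0 i by apply: sumr_ge0.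
  have wE : \sum_i w 0 i = 1 - a by rewrite -aw addrC addKr.
  have a01 : 0 <= a <= 1 by rewrite a0 -aw lerDl.
  (* Here [w] cannot be normalized, but it vanishes, so any [x] serves; [ei] is taken. *)
  have [a1|na1] := eqVneq (1 - a) 0.
    exists a, ei; split=> //; first exact: simplex_pure.
    rewrite a1 scale0r; congr (_ + _); apply/matrixP => i j; rewrite !mxE.
    move: wE; rewrite a1 => /eqP; rewrite psumr_eq0; last by move=> k _; exact: w0.
    by move=> /allP /(_ i (mem_index_enum _)) /= /eqP ->; rewrite mul0r.
  exists a, ((1 - a)^-1 *: w); split=> //; last first.
    by rewrite tensorZl scalerA mulfV // scale1r.
  split=> [i|]; first by rewrite mxE mulr_ge0 // invr_ge0 -wE.
  by under eq_bigr do rewrite mxE; rewrite -mulr_sumr wE mulVf.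
exists a, ((1 - a) *: x); split=> //.
- by move=> i; rewrite mxE mulr_ge0 // subr_ge0.
- by under eq_bigr do rewrite mxE; rewrite -mulr_sumr x1; ring.
- by rewrite tensorZl.
Qed.

Lemma trigger_menu_pure : trigger_menu (tensor ei ej).
Proof.
exists 1, 0; split=> [//|i||]; first by rewrite mxE.
  by rewrite big1 ?addr0 // => i _; rewrite mxE.
rewrite scale1r (_ : tensor 0 y = 0) ?addr0 //.
by apply/matrixP => i j; rewrite !mxE mul0r.
Qed.

Lemma trigger_menu_tensor x : simplex x -> trigger_menu (tensor x y).
Proof. by move=> [x0 x1]; exists 0, x; rewrite scale0r !add0r. Qed.

Lemma trigger_menu_convex : @convex_set R 'M[R]_(m, n) trigger_menu.
Proof.
apply/convex_setP => p q t /andP[t0 t1] [a [w [a0 w0 aw ->]]] [b [z [b0 z0 bz ->]]].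
exists (t * a + (1 - t) * b), (t *: w + (1 - t) *: z); split.
- by rewrite addr_ge0 // mulr_ge0 // subr_ge0.
- by move=> i; rewrite !mxE addr_ge0 // mulr_ge0 // subr_ge0.
- under eq_bigr do rewrite !mxE.
  rewrite big_split /= -!mulr_sumr addrACA -!mulrDr aw bz; ring.
- by apply/matrixP => i j; rewrite !mxE; ring.
Qed.

Hypothesis hy : simplex y.

Lemma trigger_menu_joint : trigger_menu `<=` @joint_simplex R m n.
Proof.
move=> phi [a [w [a0 w0 aw ->]]]; have [y0 y1] := hy; split.
  by move=> i j; rewrite !mxE addr_ge0 // mulr_ge0 ?ler0n // mulr_ge0.
transitivity (payoff (fun _ _ => 1) (a *: tensor ei ej + 1 *: tensor w y)).
  by apply: eq_bigr => i _; apply: eq_bigr => j _; rewrite mulr1 scale1r.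
rewrite payoff_comb payoff_tensor_pure mulr1 mul1r -[RHS]aw; congr (_ + _).
apply: eq_bigr => i _; under eq_bigr do rewrite mxE mulr1.
by rewrite -mulr_sumr y1 mulr1.
Qed.

Variable jp : 'I_n.
Hypotheses (jpjs : jp != js) (yjp : 0 < y 0 jp).

(** The menu is cut out of the simplex by linear relations: off [(is_, js)] every row is
    proportional to [y], and at [(is_, js)] the entry may only exceed this proportion. Each relation
    is an inequality valid on the menu, hence at [psi]. It provides both closedness and the payoffs
    that separate outside points. *)
Lemma trigger_menu_bipolar psi : joint_simplex psi ->
  (forall u, (forall phi, trigger_menu phi -> payoff u phi <= 0) ->
    payoff u psi <= 0) ->
  trigger_menu psi.
Proof.
move=> [psi0 psi1] H; have [y0 y1] := hy.
have HD i j c d : (forall phi, trigger_menu phi -> c * phi i j + d * phi i jp <= 0) ->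
    c * psi i j + d * psi i jp <= 0.
  pose u k l := c * (delta_mx i j : 'M[R]_(m, n)) k l
    + d * (delta_mx i jp : 'M[R]_(m, n)) k l.
  have uE p : payoff u p = c * p i j + d * p i jp.
    by rewrite (payoffD (fun k l => c * _ k l)) payoffZ !payoff_delta.
  by rewrite -uE => H1; apply: H => phi /H1; rewrite uE.
have phijp a w i : (a *: tensor ei ej + tensor w y) i jp = w 0 i * y 0 jp.
  by rewrite !mxE (negPf jpjs) !mulr0 add0r.
have off i j : (i, j) != (is_, js) -> y 0 jp * psi i j = y 0 j * psi i jp.
  move=> ne; have phioff a w : (a *: tensor ei ej + tensor w y) i j = w 0 i * y 0 j.
    move: ne; rewrite xpair_eqE !mxE /=.
    by case: eqP => _; case: eqP => _ //= _; rewrite ?mulr0 ?mul0r ?mulr0 add0r.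
  apply/eqP; rewrite eq_le; apply/andP; split.
    have := HD i j (y 0 jp) (- y 0 j); rewrite mulNr subr_le0; apply.
    move=> _ [a [w [_ _ _ ->]]]; rewrite phioff phijp.
    by rewrite le_eqVlt; apply/orP; left; apply/eqP; ring.
  have := HD i j (- y 0 jp) (y 0 j); rewrite addrC mulNr subr_le0; apply.
  move=> _ [a [w [_ _ _ ->]]]; rewrite phioff phijp.
  by rewrite le_eqVlt; apply/orP; left; apply/eqP; ring.
have on : y 0 js * psi is_ jp <= y 0 jp * psi is_ js.
  have := HD is_ js (- y 0 jp) (y 0 js); rewrite addrC mulNr subr_le0; apply.
  move=> _ [a [w [a0 w0 _ ->]]]; rewrite phijp !mxE !eqxx /=.
  have := mulr_ge0 (ltW yjp) a0; rewrite !mulr1.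
  by move: (y 0 jp) (y 0 js) (w 0 is_) => p q r; lra.
have yn0 : y 0 jp != 0 by rewrite gt_eqF.
(* As [jp != js], column [jp] of a menu point is [y 0 jp] times [w], so [w] is read off there; [a]
   is the excess left at [(is_, js)]. *)
pose w : 'rV[R]_m := \row_i (psi i jp / y 0 jp).
pose a := psi is_ js - w 0 is_ * y 0 js.
have psiE : psi = a *: tensor ei ej + tensor w y.
  apply/matrixP => i j; rewrite !mxE /=.
  have [[-> ->]|ne] := eqVneq (i, j) (is_, js).
    by rewrite !eqxx /a !mxE /= !mulr1 subrK.
  have -> : ((i == is_)%:R * (j == js)%:R : R) = 0.
    by move: ne; rewrite xpair_eqE; case: eqP; case: eqP; rewrite ?mulr0 ?mul0r.
  rewrite mulr0 add0r; apply: (mulfI yn0); rewrite off //.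
  by rewrite mulrA [_ * (_ / _)]mulrC divfK // mulrC.
exists a, w; split=> //.
- rewrite /a mxE subr_ge0 mulrAC ler_pdivrMr // mulrC.
  by rewrite [leRHS]mulrC.
- by move=> i; rewrite mxE divr_ge0 // ltW.
- rewrite -psi1 psiE.
  transitivity (payoff (fun _ _ => 1) (a *: tensor ei ej + 1 *: tensor w y)).
    rewrite payoff_comb payoff_tensor_pure mulr1 mul1r; congr (_ + _).
    apply: eq_bigr => i _; under [RHS]eq_bigr do rewrite mxE mulr1.
    by rewrite -mulr_sumr y1 mulr1.
  by apply: eq_bigr => i _; apply: eq_bigr => j _; rewrite mulr1 scale1r.
Qed.

Lemma closed_trigger_menu : closed trigger_menu.
Proof.
have -> : trigger_menu = @joint_simplex R m n `&`
    \bigcap_(u in [set u | forall phi, trigger_menu phi -> payoff u phi <= 0])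
      [set phi | payoff u phi <= 0].
  apply/seteqP; split=> phi.
    by move=> Mphi; split; [exact: trigger_menu_joint|move=> u /=; exact].
  by move=> [jphi Hphi]; apply: trigger_menu_bipolar => // u /Hphi.
apply: closedI; first exact: closed_joint_simplex.
by apply: closed_bigI => u _; exact: closed_payoff_le.
Qed.

Definition trigger_act (h : seq 'rV[R]_m) : 'rV[R]_n :=
  if all (pred1 ei) h then ej else y.

Lemma trigger_act_simplex (T : nat) (h : seq 'rV[R]_m) : (size h < T)%N ->
  (forall x, x \in h -> simplex x) -> simplex (trigger_act h).
Proof. by move=> _ _; rewrite /trigger_act; case: ifP => _ //; exact: simplex_pure. Qed.

Definition trigger_algorithm : learning_algorithm R m n :=
  LearningAlgorithm trigger_act_simplex.

(** The learner reacts one round late. Replacing its reply in the single round of first departure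
    from [ei] gives a point of the menu, and one round has weight [1 / (T + 1)]. *)
Lemma trigger_average_near T (x : T.+1.-tuple 'rV[R]_m) :
  (forall t, simplex (tnth x t)) ->
  exists2 q, trigger_menu q &
    forall i j, `|average_play trigger_algorithm x i j - q i j| <= T.+1%:R^-1.
Proof.
move=> xS; pose b (t : nat) := all (pred1 ei) (take t x).
have bS t (tT : (t < T.+1)%N) : b t.+1 = b t && (tnth x (Ordinal tT) == ei).
  by rewrite /b (take_nth ei) ?size_tuple // all_rcons andbC (tnth_nth ei).
have T0 : 0 < T.+1%:R^-1 :> R by rewrite invr_gt0.
have [y0 y1] := hy.
(* The reply of a learner that also sees the current action: [b t.+1] in place of the [b t] that
   governs the actual play. *)
pose f (t : 'I_T.+1) := if b t.+1 then ej else y.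
exists (T.+1%:R^-1 *: \sum_(t < T.+1) tensor (tnth x t) (f t)).
  (* The fraction of rounds before the departure, and the share in the average of the optimizer's
     actions from then on. *)
  exists (T.+1%:R^-1 * \sum_(t < T.+1 | b t.+1) 1),
    (T.+1%:R^-1 *: \sum_(t < T.+1 | ~~ b t.+1) tnth x t); split.
  - by apply: mulr_ge0; [exact: ltW|apply: sumr_ge0].
  - move=> i; rewrite mxE summxE; apply: mulr_ge0; first exact: ltW.
    by apply: sumr_ge0 => t _; case: (xS t).
  - under [X in _ + X]eq_bigr do rewrite mxE summxE.
    rewrite -mulr_sumr -mulrDr exchange_big /=.
    rewrite [X in _ * (_ + X)](eq_bigr (fun=> 1)); last by move=> t _; case: (xS t).
    rewrite (_ : _ + _ = \sum_(t < T.+1) (1 : R)).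
      by rewrite sumr_const card_ord mulVf // pnatr_eq0.
    by rewrite [RHS](bigID (fun t : 'I_T.+1 => b t.+1)).
  - rewrite (bigID (fun t : 'I_T.+1 => b t.+1)) /= scalerDr tensorZl tensor_suml.
    congr (_ + _); last first.
      by congr (_ *: _); apply: eq_bigr => t /negPf bt; rewrite /f bt.
    rewrite -scalerA scaler_suml; congr (_ *: _); apply: eq_bigr => t bt.
    rewrite scale1r /f bt; move: bt; rewrite (bS _ (ltn_ord t)) => /andP[_ /eqP].
    by rewrite (_ : Ordinal _ = t) => [->//|]; exact: val_inj.
move=> i j; rewrite !mxE !summxE -mulrBr normrM gtr0_norm // ler_piMr //.
rewrite -sumrB; apply: le_trans (ler_norm_sum _ _ _) _.
(* The bound in round [t] is 1 exactly if the departure happens there; the sum telescopes to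
   [b 0 - b T.+1], at most 1. *)
apply: (@le_trans _ _ (\sum_(t < T.+1) ((b t)%:R - (b t.+1)%:R))).
  apply: ler_sum => t _; rewrite !mxE -mulrBr normrM.
  have [x0 _] := xS t; have x1 := simplex_le1 i (xS t).
  rewrite /= /trigger_act -/(b t) /f (bS _ (ltn_ord t)).
  have d1 : `|ej 0 j - y 0 j| <= 1.
    rewrite mxE eqxx /=; have := y0 j; have := simplex_le1 j hy.
    by rewrite ler_norml; case: (j == js) => /= ? ?; apply/andP; split; lra.
  case: (b t) => /=; last by rewrite subrr normr0 mulr0 subrr.
  case: (_ == ei) => /=; first by rewrite subrr normr0 mulr0 subrr.
  by rewrite subr0 mulr_ile1 // ger0_norm.
rewrite -(big_mkord xpredT (fun t => (b t)%:R - (b t.+1)%:R)).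
rewrite (eq_bigr (fun t => - (b t.+1)%:R - - (b t)%:R)); last first.
  by move=> t _; rewrite opprK addrC.
rewrite (telescope_sumr (fun t => - (b t)%:R)) //.
by rewrite opprK /b take0 /=; case: all => /=; lra.
Qed.

End TriggerMenu.

(** * Pareto-optimality of trigger menus *)

Section TriggerPareto.
Context {R : realType} {m n : nat}.
Variables (is_ i0 : 'I_m) (js jp : 'I_n) (y : 'rV[R]_n).
Hypotheses (hi0 : i0 != is_) (hjp : jp != js) (hy : simplex y) (yjp : 0 < y 0 jp).

Let ei : 'rV[R]_m := delta_mx 0 is_.
Let ej : 'rV[R]_n := delta_mx 0 js.
Let A := trigger_algorithm is_ js hy.

Lemma horizon_menu_pure T : horizon_menu A T.+1 (tensor ei ej).
Proof.
have <- : average_play A (nseq_tuple T.+1 ei) = tensor ei ej.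
  rewrite /average_play (eq_bigr (fun=> tensor ei ej)).
    rewrite sumr_const card_ord -[tensor _ _ *+ _]scaler_nat scalerA mulVf ?scale1r //.
  move=> t _; rewrite tnth_nseq [act _ _ _]/(trigger_act _ _ _ _) /trigger_act.
  rewrite (_ : all _ _) //; apply/allP => z /mem_take.
  by rewrite mem_nseq => /andP[_ /eqP->] /=.
by apply: horizon_menu_average => t; rewrite tnth_nseq; exact: simplex_pure.
Qed.

(** The optimizer departs at once with [i0] and then plays [x]: only the first reply is [ej], all
    later ones are [y]. *)
Lemma horizon_menu_trigger T x : simplex x ->
  horizon_menu A T.+1
    (T.+1%:R^-1 *: (tensor (delta_mx 0 i0) ej + T%:R *: tensor x y)).
Proof.
move=> xS; pose s := cons_tuple (delta_mx 0 i0 : 'rV[R]_m) (nseq_tuple T x).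
have ne : (delta_mx 0 i0 : 'rV[R]_m) == ei = false.
  apply/negbTE/eqP => /rowP/(_ i0)/eqP; rewrite !mxE !eqxx (negPf hi0).
  by rewrite /= oner_eq0.
have sS t : tnth s (lift ord0 t) = x.
  by rewrite (tnth_nth x) /= nth_nseq; case: ifP.
have <- : average_play A s =
    T.+1%:R^-1 *: (tensor (delta_mx 0 i0) ej + T%:R *: tensor x y).
  rewrite /average_play big_ord_recl; congr (_ *: (_ + _)).
  rewrite (eq_bigr (fun=> tensor x y)).
    by rewrite sumr_const card_ord scaler_nat.
  by move=> t _; rewrite sS /= /trigger_act /= ne.
apply: horizon_menu_average => t; case: (unliftP ord0 t) => [k|] ->.
  by rewrite sS.
exact: simplex_pure.
Qed.

Lemma trigger_menu_horizon_near T q : trigger_menu is_ js y q ->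
  exists2 p, horizon_menu A T.+1 p & forall i j, `|q i j - p i j| <= T.+1%:R^-1.
Proof.
move=> /trigger_menuP[a [x [a01 xS ->]]]; have /andP[a0 a1] := a01.
pose p := T.+1%:R^-1 *: (tensor (delta_mx 0 i0) ej + T%:R *: tensor x y).
exists (a *: tensor ei ej + (1 - a) *: p).
  have /convex_setP := @horizon_menu_convex R m n A T.+1; apply=> //.
    exact: horizon_menu_pure.
  exact: horizon_menu_trigger.
(* The error comes from the first round alone: [d] compares [tensor x y] with what is played there,
   and lies in [[-1, 1]]. *)
move=> i j; pose d : R := x 0 i * y 0 j - (i == i0)%:R * (j == js)%:R.
have T1 : T.+1%:R != 0 :> R by rewrite pnatr_eq0.
have -> : (a *: tensor ei ej + (1 - a) *: tensor x y) i j -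
    (a *: tensor ei ej + (1 - a) *: p) i j = T.+1%:R^-1 * ((1 - a) * d).
  rewrite !mxE /d /= -[T%:R](addrK 1) natr1; field.
  by rewrite nat1r.
rewrite normrM gtr0_norm ?invr_gt0 // ler_piMr //.
rewrite normrM mulr_ile1 ?normr_ge0 //.
  by rewrite ger0_norm ?subr_ge0 // gerBl.
have [x0 _] := xS; have [y0 _] := hy.
have xy0 : 0 <= x 0 i * y 0 j by rewrite mulr_ge0.
have xy1 : x 0 i * y 0 j <= 1 by rewrite mulr_ile1 // simplex_le1.
rewrite /d ler_norml; case: (i == i0); case: (j == js);
  by rewrite /= ?mulr1 ?mulr0; apply/andP; split; lra.
Qed.

(** The points within [1 / (T + 1)] of a convex set form a convex set; it contains all average
    plays, hence their hull. *)
Lemma horizon_menu_trigger_near T p : horizon_menu A T.+1 p ->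
  exists2 q, trigger_menu is_ js y q & forall i j, `|p i j - q i j| <= T.+1%:R^-1.
Proof.
move: p; apply: smallest_sub => [|_ [x xS <-]]; last exact: trigger_average_near.
apply/convex_setP => p p' t t01 [q Mq pq] [q' Mq' pq'].
exists (t *: q + (1 - t) *: q').
  by have /convex_setP := @trigger_menu_convex R m n is_ js y; apply.
have /andP[t0 t1] := t01; move=> i j; rewrite !mxE.
have -> : t * p i j + (1 - t) * p' i j - (t * q i j + (1 - t) * q' i j) =
  t * (p i j - q i j) + (1 - t) * (p' i j - q' i j) by ring.
apply: le_trans (ler_normD _ _) _.
rewrite !normrM (ger0_norm t0) (@ger0_norm _ (1 - t)) ?subr_ge0 //.
have -> : T.+1%:R^-1 = t * T.+1%:R^-1 + (1 - t) * T.+1%:R^-1 :> R by ring.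
by apply: lerD; apply: ler_wpM2l; rewrite ?subr_ge0.
Qed.

Lemma trigger_menu_asymptotic : asymptotic_menu (trigger_menu is_ js y).
Proof.
split; first exact: trigger_menu_joint.
  exact: (closed_trigger_menu hy hjp yjp).
exists A.
suff cvgS : hausdorff_dist (horizon_menu A T.+1) (trigger_menu is_ js y)
    @[T --> \oo] --> 0%E by rewrite -cvg_shiftS; exact: cvgS.
(* The factor 2 turns the weak entrywise bounds into membership in open balls. *)
apply: (@squeeze_cvge nat \oo _ R (fun=> 0%E) _ (fun T => (2 * harmonic T)%:E)).
- apply: nearW => T; apply/andP; split.
    by apply: le_ereal_inf_tmp => _ [e [e0 _ _] <-]; rewrite lee_fin ltW.
  have lt2 : T.+1%:R^-1 < 2 * T.+1%:R^-1 :> R.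
    by rewrite ltr_pMl ?invr_gt0 // ltr1n.
  have d0 : 0 < 2 * T.+1%:R^-1 :> R by rewrite mulr_gt0 ?invr_gt0.
  apply: ereal_inf_lbound; exists (2 * T.+1%:R^-1) => //; split=> // p.
    move=> /horizon_menu_trigger_near[q Mq pq]; exists q => //.
    by apply/mx_ballP => // i j; apply: le_lt_trans lt2; exact: pq.
  move=> /(trigger_menu_horizon_near T)[q Mq pq]; exists q => //.
  by apply/mx_ballP => // i j; apply: le_lt_trans lt2; exact: pq.
- exact: cvg_cst.
apply: cvg_EFin; first exact: nearW.
rewrite -[0 in X in _ --> X](mulr0 2); apply: cvgMr; exact: cvg_harmonic.
Qed.

Lemma menu_sub_trigger_menu M : asymptotic_menu M -> M (tensor ei ej) ->
  M `<=` trigger_menu is_ js y -> trigger_menu is_ js y `<=` M.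
Proof.
move=> aM ME Msub; have [_ cM _] := aM.
have /convex_setP cvxM := menu_convex aM.
(* A row [i != is_] of a menu point is a multiple of [y]. So a response [z] to an [x] with mass on
   [i] is proportional to [y], and equal to it since both sum to 1. *)
have pos x i : simplex x -> i != is_ -> 0 < x 0 i -> M (tensor x y).
  move=> xS ii xi; have [z zS Mxz] := menu_response aM xS.
  suff -> : y = z by [].
  have [a [w [_ _ _ /matrixP xzE]]] := Msub _ Mxz.
  have zE j : z 0 j = w 0 i / x 0 i * y 0 j.
    have := xzE i j; rewrite !mxE (negPf ii) /= mul0r mulr0 add0r => xz.
    by rewrite mulrAC -xz mulrC mulKf // gt_eqF.
  have c1 : w 0 i / x 0 i = 1.
    have [_ <-] := zS; under eq_bigr do rewrite zE.
    by rewrite -mulr_sumr; case: hy => _ ->; rewrite mulr1.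
  by apply/rowP => j; rewrite zE c1 mul1r.
(* Any [x], pure [is_] included, is a limit of mixtures with a little mass on [i0], to which [pos]
   applies; [M] is closed. *)
have all x : simplex x -> M (tensor x y).
  move=> xS; apply: (closed_approx cM) => e e0.
  pose d := Num.min (e / 2) 1.
  have d0 : 0 < d by rewrite lt_min ltr01 divr_gt0.
  have d1 : d <= 1 by rewrite ge_min lexx orbT.
  have de : d < e by rewrite gt_min ltr_pdivrMr // ltr_pMr // ltr1n.
  pose z := d *: (delta_mx 0 i0 : 'rV[R]_m) + (1 - d) *: x.
  have [x0 _] := xS; have [y0 _] := hy.
  exists (tensor z y).
    apply: (@pos z i0) => //.
      by apply: simplex_comb => //; [rewrite ltW|exact: simplex_pure].
    by rewrite !mxE !eqxx mulr1 ltr_pwDl // mulr_ge0 // subr_ge0.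
  apply/mx_ballP => // i j; rewrite !mxE -mulrBl.
  have -> : x 0 i - (d * ((0 == 0 :> 'I_1) && (i == i0))%:R + (1 - d) * x 0 i) =
    d * (x 0 i - ((0 == 0 :> 'I_1) && (i == i0))%:R) by ring.
  apply: le_lt_trans de; rewrite -mulrA normrM gtr0_norm // ger_pMr //.
  rewrite normrM mulr_ile1 ?normr_ge0 //; last by rewrite ger0_norm ?simplex_le1.
  have := x0 i; have := simplex_le1 i xS.
  by rewrite ler_norml eqxx; case: (i == i0) => /= ? ?; apply/andP; split; lra.
move=> _ /trigger_menuP[a [x [a01 xS ->]]]; apply: cvxM => //; exact: all.
Qed.

Lemma trigger_menu_pareto_optimal uL : bounded_payoff uL ->
  (forall i j, (i, j) != (is_, js) -> uL i j < uL is_ js) ->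
  pareto_optimal uL (trigger_menu is_ js y).
Proof.
move=> huL hmax; split; first exact: trigger_menu_asymptotic.
move=> M aM [dom [uO _]]; have aT := trigger_menu_asymptotic.
have [jM _ _] := aM; have [jT _ _] := aT.
have TE := trigger_menu_pure is_ js y.
have [z _ Mz] := menu_response aM (@simplex_pure R m is_).
have M0 : M !=set0 by exists (tensor (delta_mx 0 is_) z).
have ME : M (tensor ei ej).
  (* Domination is used at [uO = uL], where the learner's value is the maximum of [uL] over the
     menu. *)
  have [phi [Mphi _] phiE] := learner_value_attained uL uL (menu_compact aM) M0.
  suff <- : phi = tensor ei ej by [].
  apply: (payoff_max_unique hmax); first exact: jM.
  have [psi [_ maxpsi] psiE] :=
    learner_value_attained uL uL (menu_compact aT) (ex_intro _ _ TE).
  rewrite phiE; apply: le_trans (dom _ huL); rewrite -psiE.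
  by rewrite -(payoff_tensor_pure uL is_ js); exact: maxpsi.
(* Equal menus have equal values, which refutes the strict inequality at [uO]. *)
suff -> : M = trigger_menu is_ js y by rewrite ltxx.
have Msub : M `<=` trigger_menu is_ js y.
  move=> psi Mpsi; apply: (trigger_menu_bipolar hy hjp yjp (jM _ Mpsi)) => u Hu.
  rewrite leNgt; apply/negP => psi0.
  have [|v bv] := separated_value_lt huL hmax (menu_compact aT) jT TE
    (menu_compact aM) jM Mpsi (u := u).
    by move=> phi /Hu/le_lt_trans; exact.
  by rewrite ltNge dom.
by apply/seteqP; split=> //; exact: menu_sub_trigger_menu.
Qed.

End TriggerPareto.

(** * Infinitely many distinct trigger menus *)

Theorem corollary4p11 (R : realType) (m n : nat) (hm : (1 < m)%N) (hn : (1 < n)%N)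
  (uL : 'I_m -> 'I_n -> R) (huL : bounded_payoff uL)
  (hmax : unique_max_profile uL) (hdom : no_weakly_dominated_action uL) :
  infinite_set [set M : set 'M[R]_(m, n) | pareto_optimal uL M].
Proof.
have other k (i : 'I_k) : (1 < k)%N -> exists j : 'I_k, j != i.
  move=> k1; have [i0|i0] := eqVneq (val i) 0%N.
    by exists (Ordinal k1); rewrite -val_eqE /= i0.
  by exists (Ordinal (ltnW k1)); rewrite -val_eqE /= eq_sym.
have [[is_ js] [/= is_max is_uniq]] := hmax.
have smax i j : (i, j) != (is_, js) -> uL i j < uL is_ js.
  move=> ne; rewrite lt_neqAle (is_max (i, j)) andbT.
  apply: contra ne => /eqP e; rewrite eq_sym; apply/eqP; apply: is_uniq => q.
  by rewrite /= e; exact: is_max.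
have [i0 hi0] := other _ is_ hm; have [jp hjp] := other _ js hn.
(* Distinct weights on [jp], all positive as the trigger menus require, and at most 1. *)
pose s (k : nat) : R := k.+1%:R^-1.
pose y k : 'rV[R]_n := s k *: delta_mx 0 jp + (1 - s k) *: delta_mx 0 js.
have s0 k : 0 < s k by rewrite invr_gt0.
have s1 k : s k <= 1 by rewrite invf_le1 // ler1n.
have yS k : simplex (y k).
  by apply: simplex_comb; [rewrite ltW //= s1|exact: simplex_pure|exact: simplex_pure].
have yjp k : y k 0 jp = s k.
  by rewrite !mxE !eqxx (negPf hjp) mulr1 mulr0 addr0.
have yjs k : y k 0 js = 1 - s k.
  by rewrite !mxE !eqxx eq_sym (negPf hjp) mulr0 add0r mulr1.
pose F k := trigger_menu is_ js (y k).
move=> finP; apply: infinite_nat.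
have -> : [set: nat] = F @^-1` [set M | pareto_optimal uL M].
  apply/seteqP; split=> // k _ /=.
  by apply: (trigger_menu_pareto_optimal hi0 hjp) => //; rewrite yjp.
(* Injectivity of [F]: row [i0] of a point of [F l] is a multiple of [y l]. Hence [y k] is a
   multiple of [y l], and adding the entries at [jp] and [js] shows that the factor is 1. *)
apply: finite_preimage finP => k l _ _ Fkl.
have : F l (tensor (delta_mx 0 i0) (y k)).
  by rewrite -Fkl; apply: trigger_menu_tensor; exact: simplex_pure.
move=> [a [w [_ _ _ /matrixP E]]].
have yE j : y k 0 j = w 0 i0 * y l 0 j.
  by have := E i0 j; rewrite !mxE !eqxx (negPf hi0) /= mul0r mulr0 mul1r add0r.
have := yE jp; have := yE js; rewrite !yjp !yjs => e1 e2.
have w1 : w 0 i0 = 1 by move: e1; rewrite e2; lra.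
by move: e2; rewrite w1 mul1r => /invr_inj/eqP; rewrite eqr_nat => /eqP[].
Qed.
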